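(* (The Second Rogers-Ramanujan Identity.) Let $K$ be a totally real number field and $\mathcal O^+$ the set of totally positive algebraic integers of $K$. For every $\delta\in\mathcal O^+$, the partitions of $\delta$ in which the scale of each part is congruent to $2$ or $3$ modulo $5$ are equinumerous with the partitions $\lambda=(\lambda_1,\ldots,\lambda_r)$ of $\delta$ in which there is no primitive part and the difference between the scales of any two parts in the same section is at least $2$ (i.e. $|s(\lambda_a)-s(\lambda_b)|\ge2$ whenever $a\ne b$ and $t(\lambda_a)=t(\lambda_b)$).
   Context: A partition of $\delta\in\mathcal O^+$ is a finite sequence $\lambda=(\lambda_1,\ldots,\lambda_r)$ of elements of $\mathcal O^+$ (the parts) with $\lambda_1+\cdots+\lambda_r=\delta$; partitions are considered (and counted) up to change of order, i.e. as multisets. Each $\delta\in\mathcal O^+$ has only finitely many partitions. An element $\gamma\in\mathcal O^+$ is primitive if $\gamma\notin n\mathcal O^+$ for every rational integer $n\ge 2$. Every $\delta\in\mathcal O^+$ can be written uniquely as $\delta=s(\delta)t(\delta)$ with $s(\delta)\in\mathbb Z^+$ (the scale) and $t(\delta)$ primitive (the primitive factor). Two elements of $\mathcal O^+$ are in the same section if they have the same primitive factor. *)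

(* Defs.v *)
From HB Require Import structures.
From mathcomp Require Import all_boot all_order all_algebra all_field.
From mathcomp Require Import finmap multiset.
From mathcomp Require Import boolp classical_sets functions cardinality.

Set Implicit Arguments.
Unset Strict Implicit.
Unset Printing Implicit Defensive.

Import Order.TTheory GRing.Theory Num.Theory.
Local Open Scope mset_scope.
Local Open Scope classical_set_scope.
Local Open Scope ring_scope.

(* A number field is a finite extension K of rat. Its complex embeddings are
   its ring morphisms to algC: every embedding of K into the complex numbers
   takes algebraic values. *)
Definition totally_real (K : fieldExtType rat) : Prop :=
  forall (f : {rmorphism K -> algC}) (x : K), f x \is Num.real.

Definition totally_positive (K : fieldExtType rat) (x : K) : Prop :=
  forall f : {rmorphism K -> algC}, 0 < f x.

Definition algebraic_integer (K : fieldExtType rat) (x : K) : Prop :=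
  integralOver (intr : int -> K) x.

Definition Oplus (K : fieldExtType rat) : set K :=
  [set x | algebraic_integer x /\ totally_positive x].

Definition primitive (K : fieldExtType rat) (x : K) : Prop :=
  Oplus x /\
  forall n : nat, (2 <= n)%N -> ~ exists2 y, Oplus y & x = n%:R * y.

(* The unique decomposition x = s(x) t(x) of x in Oplus, as the pair
   (s(x), t(x)); the default value (0, 0) is for x outside Oplus. *)
Definition scale_primitive (K : fieldExtType rat) (x : K) : nat * K :=
  xget (0%N, 0)
    [set p : nat * K | [/\ (0 < p.1)%N, primitive p.2 & x = p.1%:R * p.2]].

Definition scale (K : fieldExtType rat) (x : K) : nat := (scale_primitive x).1.

Definition primitive_factor (K : fieldExtType rat) (x : K) : K :=
  (scale_primitive x).2.

Definition same_section (K : fieldExtType rat) (x y : K) : Prop :=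
  primitive_factor x = primitive_factor y.

(* Partitions up to reordering are finite multisets; enum_mset lists the
   parts with their multiplicities, in an unspecified order. *)
Definition partition_of (K : fieldExtType rat) (d : K) (m : {mset K}) : Prop :=
  (forall x, x \in enum_mset m -> Oplus x) /\ \sum_(x <- enum_mset m) x = d.

Definition scales_2_or_3_mod_5 (K : fieldExtType rat) (m : {mset K}) : Prop :=
  forall x, x \in enum_mset m ->
    scale x = 2 %[mod 5] \/ scale x = 3 %[mod 5].

Definition no_primitive_part (K : fieldExtType rat) (m : {mset K}) : Prop :=
  forall x, x \in enum_mset m -> ~ primitive x.

(* Parts are compared by position, so that a repeated part counts as two
   parts in the same section. *)
Definition scales_differ_by_2 (K : fieldExtType rat) (m : {mset K}) : Prop :=
  let part a := nth 0 (enum_mset m) a in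
  forall a b : nat,
    (a < size (enum_mset m))%N -> (b < size (enum_mset m))%N -> a <> b ->
    same_section (part a) (part b) ->
    2 <= `|(scale (part a))%:Z - (scale (part b))%:Z|.

(* Main.v *)
(* The map i |-> i t identifies the parts of a partition of d lying in the
   section of a primitive t with a partition of a positive integer, so a
   partition of d is a finite family of ordinary partitions indexed by the
   primitive elements, and a sum-preserving bijection between two classes of
   ordinary partitions, applied section by section, transports to partitions
   of d. This reduces the statement to the second Rogers-Ramanujan identity for
   the integers.

   The latter is proved by Schur's method. Partitions with parts in [2, k] and
   gaps at least 2 have generating polynomials with e_(k+2) = e_(k+1) +
   q^(k+2) e_k, a recurrence also satisfied by the alternating sums over j of
   (-1)^j q^(j(5j-3)/2) [k+1 choose floor((k+1-5j)/2) + 1]_q. Modulo q^N, for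
   k large, such a sum times (q;q)_N is congruent to the sum of the (-1)^j
   q^(j(5j-3)/2), and a finite form of the Jacobi triple product at base q^5
   identifies it with the product of the 1 - q^i for i = 0, 1, 4 mod 5.

   Decompositions x = s(x) t(x) exist because K embeds in the complex numbers,
   so that totally positive elements are nonzero, and because a nonzero
   algebraic integer is divisible by finitely many positive integers. *)

From HB Require Import structures.
Require Import Defs.
From mathcomp Require Import all_boot all_order all_algebra all_field.
From mathcomp Require Import ring zify.
From mathcomp Require Import finmap multiset.
From mathcomp Require Import boolp classical_sets functions cardinality.

Set Implicit Arguments.
Unset Strict Implicit.
Unset Printing Implicit Defensive.

Import Order.TTheory GRing.Theory Num.Theory.
Local Open Scope mset_scope.
Local Open Scope ring_scope.

(** * Gaussian binomial coefficients *)

Section QBinomial.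
Variable R : comNzRingType.
Implicit Types (q y z : R) (n m k : nat).

Definition qfact q n : R := \prod_(i < n) (1 - q ^+ i.+1).

(** Defining the Gaussian binomial by a q-Pascal rule avoids division, so it makes sense over any
    commutative ring. *)
Fixpoint qbin q n k : R :=
  match n, k with
  | _, 0 => 1
  | 0, _.+1 => 0
  | n.+1, k.+1 => qbin q n k + q ^+ k.+1 * qbin q n k.+1
  end.

Arguments qbin : simpl never.

Lemma qfactS q n : qfact q n.+1 = qfact q n * (1 - q ^+ n.+1).
Proof. by rewrite /qfact big_ord_recr. Qed.

Lemma qbin0 q n : qbin q n 0 = 1.
Proof. by case: n. Qed.

Lemma qbinS q n k :
  qbin q n.+1 k.+1 = qbin q n k + q ^+ k.+1 * qbin q n k.+1.
Proof. by []. Qed.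

Lemma qbin_small q n k : (n < k)%N -> qbin q n k = 0.
Proof.
elim: n k => [|n IHn] [|k] // ltnk.
by rewrite qbinS !IHn ?mulr0 ?addr0 // ltnW.
Qed.

(** Double induction, using 1 - q^(k+m+2) = (1 - q^(k+1)) + q^(k+1) (1 - q^(m+1)). Writing the row
    as [k + m] avoids subtraction. *)
Lemma qbin_fact q k m : qbin q (k + m) k * (qfact q k * qfact q m) = qfact q (k + m).
Proof.
elim: k m => [|k IHk] m; first by rewrite qbin0 /qfact big_ord0 !mul1r.
elim: m => [|m IHm].
  have := IHk 0; rewrite !addn0 qbinS (@qbin_small q k k.+1) // mulr0 addr0 !qfactS => E.
  rewrite -[in RHS]E.
  by rewrite /qfact big_ord0; ring.
have E1 := IHk m.+1; rewrite !addnS in E1.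
rewrite addSn in IHm; rewrite addSn addnS qbinS [in RHS]qfactS.
have -> : (k + m).+2 = (k.+1 + m.+1)%N by lia.
rewrite exprD -[in LHS](addnS k m) addnS mulrDl.
rewrite (_ : qbin q _ k * _ = qfact q (k + m).+1 * (1 - q ^+ k.+1)); last first.
  by rewrite -E1 !qfactS; ring.
rewrite -{2}IHm (qfactS q m) -IHm. ring.
Qed.

(** Peeling off the factor i = 0 leaves the same product with [z * q] in place of [z]. *)
Lemma qbinomial_theorem q y z n :
  \prod_(i < n) (y + z * q ^+ i) =
  \sum_(k < n.+1) q ^+ 'C(k, 2) * qbin q n k * z ^+ k * y ^+ (n - k).
Proof.
elim: n y z => [|n IHn] y z.
  by rewrite big_ord0 big_ord_recl big_ord0 /= !mulr1 addr0.
rewrite big_ord_recl /= mulr1.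
rewrite (eq_bigr (fun i : 'I_n => y + (z * q) * q ^+ i)); last first.
  by move=> i _; rewrite /bump leq0n add1n exprS mulrA.
rewrite IHn [in RHS]big_ord_recl qbin0 /= !mulr1 subn0 mul1r.
rewrite [X in _ = _ + X](_ : _
  = \sum_(i < n.+1) q ^+ 'C(i, 2) * qbin q n i * (z * q) ^+ i * y ^+ (n - i) * z
  + \sum_(i < n.+1) q ^+ 'C(i.+1, 2) * qbin q n i.+1 * (z * q) ^+ i.+1 * y ^+ (n - i));
    last first.
  rewrite -big_split /=; apply: eq_bigr => i _.
  rewrite /bump leq0n add1n qbinS subSS binS bin1 addnC exprD !exprMn.
  by rewrite (exprS z); ring.
rewrite mulrDl [RHS]addrCA [LHS]addrC; congr (_ + _).
  by rewrite -mulr_suml mulrC.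
rewrite big_ord_recl [in RHS]big_ord_recr /= (@qbin_small q n n.+1) // mulr0 !mul0r addr0.
rewrite qbin0 !mulr1 mul1r subn0 mulrDr -exprS mulr_sumr; congr (_ + _).
apply: eq_bigr => i _; rewrite /bump leq0n add1n.
have -> : (n - i = (n - i.+1).+1)%N by have := ltn_ord i; lia.
by rewrite (exprS y); ring.
Qed.

End QBinomial.
Arguments qbin : simpl never.

(** * Schur's alternating sums *)

Section Schur.
Variables (R : comNzRingType) (q : R).
Implicit Types (j k : int) (n m : nat).

(** The second q-Pascal rule, with the power of q on the other term; it follows from the first by
    double induction. *)
Lemma qbinS_sym (k m : nat) :
  qbin q (k + m)%N.+1 k.+1 = qbin q (k + m)%N k.+1 + q ^+ m * qbin q (k + m)%N k.
Proof.
elim: k m => [|k IHk] m.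
  elim: m => [|m IHm]; first by rewrite addn0 qbinS !(@qbin_small _ q 0 1) // !qbin0; ring.
  rewrite add0n in IHm; rewrite add0n qbinS {1}IHm qbinS !qbin0 mulrDr.
  by rewrite (exprS _ m); ring: IHm.
elim: m => [|m IHm].
  by rewrite addn0 qbinS (@qbin_small _ q k.+1 k.+2) //; ring.
have H1 := IHk m.+1; rewrite addnS in H1; rewrite addSn in IHm.
rewrite addSn addnS [LHS]qbinS {1}H1 {1}IHm (qbinS q (k + m).+1 k.+1).
by rewrite (qbinS q (k + m).+1 k) (exprS _ m) (exprS _ k.+1); ring.
Qed.

(** Extension by zero to negative lower indices, so that both Pascal rules hold for every integer
    index and sums over j need no boundary cases. *)
Definition qbinz n k : R := if k is Posz i then qbin q n i else 0.

Arguments qbinz : simpl never.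

Lemma qbinz_nat n (i : nat) : qbinz n i = qbin q n i. Proof. by []. Qed.

Lemma qbinz_lt0 n k : k < 0 -> qbinz n k = 0.
Proof. by case: k. Qed.

Lemma qbinz_gt n k : n%:Z < k -> qbinz n k = 0.
Proof. by case: k => // k lt_nk; rewrite qbinz_nat qbin_small //; lia. Qed.

Lemma qbinzS n k :
  qbinz n.+1 k = qbinz n (k - 1) + q ^+ `|k|%N * qbinz n k.
Proof.
case: k => [[|k]|k]; last by rewrite !qbinz_lt0 ?mulr0 ?addr0 //; lia.
  by rewrite !qbinz_nat !qbin0 qbinz_lt0 // mul1r add0r.
by rewrite (_ : k.+1%:Z - 1 = k) ?qbinz_nat ?qbinS //; lia.
Qed.

Lemma qbinzS_sym n k :
  qbinz n.+1 k = qbinz n k + q ^+ `|(n.+1%:Z - k)%R|%N * qbinz n (k - 1).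
Proof.
case: k => [[|k]|k]; last by rewrite !qbinz_lt0 ?mulr0 ?addr0 //; lia.
  by rewrite !qbinz_nat !qbin0 qbinz_lt0 // mulr0 addr0.
rewrite (_ : k.+1%:Z - 1 = k) ?qbinz_nat; last by lia.
case: (leqP k n) => [le_kn | lt_nk]; last first.
  by rewrite !qbin_small // ?mulr0 ?addr0 //; lia.
rewrite -[in LHS](subnKC le_kn) qbinS_sym subnKC // (_ : absz _ = (n - k)%N) //; lia.
Qed.

(** Generalized heptagonal numbers. The quotient is exact and nonnegative for every integer j, so
    neither the division nor the absolute value loses anything. *)
Definition pent j : nat := `|(j * (5 * j - 3) %/ 2)%Z|%N.

Lemma pentE j : 2 * (pent j)%:Z = j * (5 * j - 3).
Proof.
rewrite /pent.
have [i [->|->]] : exists i, j = 2 * i \/ j = 2 * i + 1.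
  by exists (j %/ 2)%Z; lia.
- have -> : 2 * i * (5 * (2 * i) - 3) = i * (10 * i - 3) * 2 by ring.
  rewrite mulzK // gez0_abs; first by ring.
  by case: (lerP i 0) => ?; [apply: mulr_le0; lia | apply: mulr_ge0; lia].
- have -> : (2 * i + 1) * (5 * (2 * i + 1) - 3) = (2 * i + 1) * (5 * i + 1) * 2 by ring.
  rewrite mulzK // gez0_abs; first by ring.
  by case: (ltrP i 0) => ?; [apply: mulr_le0; lia | apply: mulr_ge0; lia].
Qed.

Definition schur_index n j : int := ((n%:Z - 5 * j + 2) %/ 2)%Z.

Definition schur_term n j : R :=
  (-1) ^+ `|j|%N * q ^+ pent j * qbinz n (schur_index n j).

(* Defect of the Schur recurrence in a single term; it telescopes over [j]. *)
Definition schur_defect n j : R :=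
  if (2 %| n%:Z - 5 * j)%Z then
    let k := schur_index n.+2 j in
    (-1) ^+ `|j|%N * q ^+ (pent j + `|k|%N) * qbinz n k
  else 0.

Lemma signr_absz_succ j : (-1) ^+ `|(j + 1)%R|%N = - (-1) ^+ `|j|%N :> R.
Proof.
rewrite -signr_odd -[in RHS]signr_odd (_ : odd _ = ~~ odd `|j|%N); last by lia.
by rewrite signrN.
Qed.

(** The parity of n - 5j decides in which order the two Pascal rules are applied. The remaining term
    is the defect at j in the even case, minus the defect at j + 1 in the odd case. *)
Lemma schur_term_rec n j :
  schur_term n.+2 j = schur_term n.+1 j + q ^+ n.+1 * schur_term n j
                      + (schur_defect n j - schur_defect n (j + 1)).
Proof.
have Ej := pentE j; have Ej1 := pentE (j + 1).
have Esq : (j + 1) * (5 * (j + 1) - 3) = j * (5 * j - 3) + 10 * j + 2 by ring.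
rewrite /schur_term /schur_defect signr_absz_succ.
set k := schur_index n.+2 j.
have kE : k = ((n.+2%:Z - 5 * j + 2) %/ 2)%Z by [].
have -> : schur_index n j = k - 1 by rewrite /schur_index; lia.
case: ifP => evj.
  rewrite ifF; last by apply/negbTE; lia.
  have -> : schur_index n.+1 j = k - 1 by rewrite /schur_index; lia.
  rewrite [qbinz n.+2 k]qbinzS [qbinz n.+1 k]qbinzS_sym.
  (* Outside 0 <= k - 1 <= n both sides vanish; inside, the exponents k and n + 1 - k add up to n +
     1. *)
  have E : q ^+ `|k|%N * (q ^+ `|(n.+1%:Z - k)%R|%N * qbinz n (k - 1))
         = q ^+ n.+1 * qbinz n (k - 1).
    case: (ltrP (k - 1) 0) => [/qbinz_lt0->|k_ge]; first by rewrite !mulr0.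
    case: (ltrP n%:Z (k - 1)) => [/qbinz_gt->|k_le]; first by rewrite !mulr0.
    by rewrite mulrA -exprD; congr (q ^+ _ * _); lia.
  by rewrite (mulrDr (q ^+ `|k|%N)) E exprD; ring.
rewrite ifT; last by lia.
have -> : schur_index n.+1 j = k by rewrite /schur_index; lia.
have -> : schur_index n.+2 (j + 1) = k - 2 by rewrite /schur_index; lia.
rewrite [qbinz n.+2 k]qbinzS_sym [qbinz n.+1 (k - 1)]qbinzS.
have E : q ^+ `|(n.+2%:Z - k)%R|%N * (q ^+ `|(k - 1)%R|%N * qbinz n (k - 1))
       = q ^+ n.+1 * qbinz n (k - 1).
  case: (ltrP (k - 1) 0) => [/qbinz_lt0->|k_ge]; first by rewrite !mulr0.
  case: (ltrP n%:Z (k - 1)) => [/qbinz_gt->|k_le]; first by rewrite !mulr0.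
  by rewrite mulrA -exprD; congr (q ^+ _ * _); lia.
have -> : k - 1 - 1 = k - 2 by lia.
(* The exponents agree because 2k = n - 5j + 3 and pent (j + 1) = pent j + 5j + 1. *)
have E2 : q ^+ (pent j) * (q ^+ `|(n.+2%:Z - k)%R|%N * qbinz n (k - 2))
        = q ^+ (pent (j + 1) + `|(k - 2)%R|%N) * qbinz n (k - 2).
  case: (ltrP (k - 2) 0) => [/qbinz_lt0->|k_ge]; first by rewrite !mulr0.
  case: (ltrP n%:Z (k - 2)) => [/qbinz_gt->|k_le]; first by rewrite !mulr0.
  by rewrite mulrA -exprD; congr (q ^+ _ * _); lia.
rewrite sub0r !mulNr opprK -[_ * q ^+ (pent (j + 1) + _) * _]mulrA -E2.
by rewrite (mulrDr (q ^+ `|(n.+2%:Z - k)%R|%N)) E; ring.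
Qed.

Definition schur_sum M n : R := \sum_(i < (2 * M).+1) schur_term n (i%:Z - M%:Z).

Lemma schur_sum_rec M n : (n <= 5 * M)%N ->
  schur_sum M n.+2 = schur_sum M n.+1 + q ^+ n.+1 * schur_sum M n.
Proof.
move=> le_nM; rewrite /schur_sum mulr_sumr -big_split /=.
under eq_bigr => i _ do rewrite schur_term_rec.
rewrite big_split /= -[RHS]addr0; congr (_ + _).
rewrite -(big_mkord xpredT (fun i : nat => schur_defect n (i%:Z - M%:Z)
            - schur_defect n (i%:Z - M%:Z + 1))) /=.
rewrite (eq_bigr (fun i : nat => - (schur_defect n (i.+1%:Z - M%:Z)
            - schur_defect n (i%:Z - M%:Z)))); last first.
  by move=> i _; rewrite opprB; congr (_ - schur_defect _ _); lia.
rewrite sumrN telescope_sumr // /schur_defect.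
(* The telescoped ends are j = M + 1 and j = -M, where [n <= 5 * M] puts the lower index outside
   [0, n]. *)
rewrite [qbinz n (schur_index n.+2 ((2 * M).+1%:Z - M%:Z))]qbinz_lt0; last first.
  by rewrite /schur_index; lia.
rewrite [qbinz n (schur_index n.+2 (0%N%:Z - M%:Z))]qbinz_gt; last first.
  by rewrite /schur_index; lia.
by rewrite !mulr0 !if_same subr0 oppr0.
Qed.

(** Row 0 has its only nonzero coefficient at index 0, and floor((2 - 5j) / 2) is never 0. *)
Lemma schur_sum0 M : schur_sum M 0 = 0.
Proof.
apply: big1 => i _; rewrite /schur_term.
have [lt0|ge0] := ltrP (schur_index 0 (i%:Z - M%:Z)) 0.
  by rewrite qbinz_lt0 ?mulr0.
by rewrite qbinz_gt ?mulr0 //; move: ge0; rewrite /schur_index; lia.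
Qed.

Lemma schur_sum1 M : schur_sum M 1 = 1.
Proof.
have ltM : (M < (2 * M).+1)%N by lia.
rewrite /schur_sum (bigD1 (Ordinal ltM)) //= big1 ?addr0.
  rewrite subrr /schur_term; have -> : schur_index 1 0 = 1%N by [].
  have -> : pent 0 = 0%N by [].
  by rewrite qbinz_nat qbinS !qbin0 qbin_small // !expr0 !mul1r mulr0 addr0.
move=> i /eqP neq; rewrite /schur_term.
have {}neq : i%:Z - M%:Z <> 0.
  by move=> E; apply: neq; apply: val_inj => /=; lia.
have [lt0|ge0] := ltrP (schur_index 1 (i%:Z - M%:Z)) 0.
  by rewrite qbinz_lt0 ?mulr0.
by rewrite qbinz_gt ?mulr0 //; move: ge0; rewrite /schur_index; lia.
Qed.

End Schur.
Arguments qbinz : simpl never.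

(** * Jacobi triple product *)

Section TripleProduct.
Variables (R : idomainType) (q : R).

Lemma bin2_double n : (2 * 'C(n.+1, 2) = n.+1 * n)%N.
Proof. by elim: n => // n IHn; rewrite binS bin1; lia. Qed.

Lemma signr_absz_sub (k m : nat) :
  (-1) ^+ k = (-1) ^+ m * (-1) ^+ `|(k%:Z - m%:Z)%R|%N :> R.
Proof.
rewrite -exprD -signr_odd -[RHS]signr_odd; congr (_ ^+ nat_of_bool _); lia.
Qed.

(* The q-binomial theorem at base [q ^+ 5], [y = q ^+ (5 * m - 1)], [z = -1]:
   both sides carry the factor [(-1) ^+ m * q ^+ (5 * 'C(m, 2) + (5 * m - 1) * m)]. *)
Lemma triple_product m : q != 0 ->
  \prod_(i < m) ((1 - q ^+ (5 * i + 1)) * (1 - q ^+ (5 * i + 4))) =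
  \sum_(i < (2 * m).+1)
     (-1) ^+ `|(i%:Z - m%:Z)%R|%N * q ^+ pent (i%:Z - m%:Z) * qbin (q ^+ 5) (2 * m) i.
Proof.
move=> q_neq0.
(* The case m = 0 is treated apart because the exponent 5m - 1 would be truncated. *)
case: m => [|m].
  by rewrite big_ord0 big_ord_recl big_ord0 qbin0 !mulr1 addr0.
pose A := (5 * m + 4)%N; pose D := (5 * 'C(m.+1, 2) + A * m.+1)%N.
have nz : (-1) ^+ m.+1 * q ^+ D != 0 by rewrite mulf_neq0 ?expf_neq0 ?oppr_eq0 ?oner_eq0.
apply: (mulfI nz).
have prod_const x : x ^+ m.+1 = \prod_(i < m.+1) x by rewrite prodr_const card_ord.
have E := qbinomial_theorem (q ^+ 5) (q ^+ A) (-1) (m.+1 + m.+1).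
rewrite big_split_ord /= addnn -mul2n in E.
transitivity ((\prod_(i < m.+1) (q ^+ A + -1 * (q ^+ 5) ^+ i)) *
              (\prod_(i < m.+1) (q ^+ A + -1 * (q ^+ 5) ^+ (m.+1 + i)))).
  (* In the lower half q^A - q^(5i) = -q^(5i) (1 - q^(A - 5i)), and reversing the order of the
     factors turns A - 5i into 5i + 4. In the upper half 5(m + 1) = A + 1, so q^A comes out of each
     factor. *)
  have -> : \prod_(i < m.+1) (q ^+ A + -1 * (q ^+ 5) ^+ i) =
      (-1) ^+ m.+1 * q ^+ (5 * 'C(m.+1, 2)) * \prod_(i < m.+1) (1 - q ^+ (5 * i + 4)).
    rewrite -bin2_sum big_mkord exprM expr_sum prod_const.
    rewrite [X in _ = _ * X](reindex_inj rev_ord_inj) -!big_split /=.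
    apply: eq_bigr => i _; have := ltn_ord i => lt_im.
    have -> : A = (5 * i + (5 * (m.+1 - i.+1) + 4))%N by rewrite /A; lia.
    by rewrite exprD exprM; ring.
  have -> : \prod_(i < m.+1) (q ^+ A + -1 * (q ^+ 5) ^+ (m.+1 + i)) =
      q ^+ (A * m.+1) * \prod_(i < m.+1) (1 - q ^+ (5 * i + 1)).
    rewrite [q ^+ (A * _)]exprM prod_const -big_split /=.
    apply: eq_bigr => i _.
    by rewrite -exprM (_ : 5 * (m.+1 + i) = A + (5 * i + 1))%N ?(exprD q A);
      [ring | rewrite /A; lia].
  by rewrite /D exprD big_split /=; ring.
rewrite E mulr_sumr; apply: eq_bigr => i _.
rewrite (signr_absz_sub i m.+1) -exprM.
have Epent := pentE (i%:Z - m.+1%:Z).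
have Esq : (i%:Z - m.+1%:Z) * (5 * (i%:Z - m.+1%:Z) - 3) =
  5 * (i%:Z * i%:Z) - 10 * (i%:Z * m.+1%:Z) + 5 * (m.+1%:Z * m.+1%:Z)
   - 3 * i%:Z + 3 * m.+1%:Z by ring.
have Em := bin2_double m.
have Ei : (2 * 'C(i, 2) + i = i * i)%N.
  by case: {Epent Esq} (i : nat) => // i'; rewrite bin2_double; lia.
have lt_i := ltn_ord i.
(* The exponents are compared after doubling, where the binomials and [pent] become polynomials. *)
have Eq : (5 * 'C(i, 2) + A * (2 * m.+1 - i) = D + pent (i%:Z - m.+1%:Z))%N.
  rewrite /D /A in Em *.
  by nia.
have {}Eq : q ^+ (5 * 'C(i, 2)) * (q ^+ A) ^+ (2 * m.+1 - i) = q ^+ D * q ^+ pent (i%:Z -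
  m.+1%:Z).
  by rewrite -exprM -!exprD Eq.
transitivity ((-1) ^+ m.+1 * (-1) ^+ `|(i%:Z - m.+1%:Z)%R|%N * qbin (q ^+ 5) (2 * m.+1) i *
   (q ^+ (5 * 'C(i, 2)) * (q ^+ A) ^+ (2 * m.+1 - i))); first by ring.
by rewrite Eq; ring.
Qed.
End TripleProduct.

(** * Congruence of polynomials modulo X^N, in place of formal power series *)

Definition eqmodX (N : nat) (p r : {poly rat}) : Prop := 'X^N %| p - r.

Section EqModX.
Variable N : nat.
Implicit Types p r s t : {poly rat}.

Lemma eqmodX_refl p : eqmodX N p p.
Proof. by rewrite /eqmodX subrr dvdp0. Qed.

Lemma eqmodX_sym p r : eqmodX N p r -> eqmodX N r p.
Proof. by rewrite /eqmodX -opprB dvdpNr. Qed.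

Lemma eqmodX_trans r p s : eqmodX N p r -> eqmodX N r s -> eqmodX N p s.
Proof.
by rewrite /eqmodX => pr rs; rewrite -(subrKA r); apply: dvdp_add.
Qed.

Lemma eqmodXD p p' r r' :
  eqmodX N p p' -> eqmodX N r r' -> eqmodX N (p + r) (p' + r').
Proof. by rewrite /eqmodX opprD addrACA; apply: dvdp_add. Qed.

Lemma eqmodXM p p' r r' :
  eqmodX N p p' -> eqmodX N r r' -> eqmodX N (p * r) (p' * r').
Proof.
rewrite /eqmodX => pp' rr'.
have -> : p * r - p' * r' = (p - p') * r + p' * (r - r') by ring.
by apply: dvdp_add; [apply: dvdp_mulr | apply: dvdp_mull].
Qed.

Lemma eqmodXMl s p r : eqmodX N p r -> eqmodX N (s * p) (s * r).
Proof. exact/eqmodXM/eqmodX_refl. Qed.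

Lemma eqmodX_sum (I : Type) (l : seq I) (F G : I -> {poly rat}) :
  (forall i, eqmodX N (F i) (G i)) ->
  eqmodX N (\sum_(i <- l) F i) (\sum_(i <- l) G i).
Proof.
move=> FG; elim/big_rec2: _ => [|i p r _ pr]; first exact: eqmodX_refl.
exact: eqmodXD.
Qed.

Lemma eqmodX_monom0 n : (N <= n)%N -> eqmodX N 'X^n 0.
Proof. by move=> leNn; rewrite /eqmodX subr0 dvdp_exp2l. Qed.

(** A nonzero constant term makes [s] coprime to X^N; this is how products are divided out. *)
Lemma eqmodX_cancel s p r : s.[0] != 0 ->
  eqmodX N (s * p) (s * r) -> eqmodX N p r.
Proof.
move=> s0; rewrite /eqmodX -mulrBr Gauss_dvdpr //.
by rewrite coprimep_expl // coprimep_sym -['X]subr0 -polyC0 coprimep_XsubC.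
Qed.

Lemma eqmodX_coef p r i : (i < N)%N -> eqmodX N p r -> p`_i = r`_i.
Proof.
move=> lt_iN /dvdpP [s]; move/(congr1 (fun u : {poly rat} => u`_i)).
by rewrite coefB coefMXn lt_iN => /eqP; rewrite subr_eq0 => /eqP.
Qed.

Lemma qfact_X0 a n : (0 < a)%N -> (qfact ('X^a : {poly rat}) n).[0] = 1.
Proof.
move=> a_gt0; rewrite /qfact horner_prod big1 // => i _.
by rewrite -exprM !hornerE expr0n muln_eq0 -leqn0 leqNgt a_gt0 subr0.
Qed.

Lemma eqmodX_qfact a n : (0 < a)%N -> (N <= n)%N ->
  eqmodX N (qfact 'X^a n) (qfact 'X^a N).
Proof.
move=> a_gt0 /subnKC <-; elim: (n - N)%N => [|d IHd].
  by rewrite addn0; apply: eqmodX_refl.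
rewrite addnS qfactS -[X in eqmodX _ _ X]mulr1; apply: eqmodXM => //.
rewrite -[X in eqmodX _ _ X]subr0 -exprM; apply: eqmodXD; first exact: eqmodX_refl.
rewrite /eqmodX -opprD dvdpNr subr0 dvdp_exp2l //; nia.
Qed.

(** With both indices at least N, the three q-factorials of the factorial formula all agree with
    (X^a; X^a)_N modulo X^N. *)
Lemma eqmodX_qbin a k m : (0 < a)%N -> (N <= k)%N -> (N <= m)%N ->
  eqmodX N (qbin 'X^a (k + m) k * qfact 'X^a N) 1.
Proof.
move=> a_gt0 le_Nk le_Nm.
apply: (@eqmodX_cancel (qfact 'X^a N)); first by rewrite qfact_X0 ?oner_eq0.
apply: (@eqmodX_trans (qfact 'X^a (k + m))); last first.
  by rewrite mulr1; apply: eqmodX_qfact; lia.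
rewrite -qbin_fact mulrCA; apply: eqmodXMl; apply: eqmodX_sym.
by apply: eqmodXM; apply: eqmodX_qfact.
Qed.

End EqModX.

(** * The Rogers-Ramanujan product modulo X^N *)

Definition pent_sum M : {poly rat} :=
  \sum_(i < (2 * M).+1) (-1) ^+ `|(i%:Z - M%:Z)%R|%N * 'X^(pent (i%:Z - M%:Z)).

Lemma leq_pent (j : int) : (`|j| <= pent j)%N.
Proof.
have := pentE j; case: (intP j) => // n; rewrite -?[- _ * _]mulNr; nia.
Qed.

(** Terms with |j| >= N vanish modulo X^N because pent j >= |j|, so [b] need only be inverse to [u]
    for the central j. *)
Lemma eqmodX_pent_term N (j : int) (b : {poly rat}) u :
  ((`|j| < N)%N -> eqmodX N (b * u) 1) ->
  eqmodX N ((-1) ^+ `|j|%N * 'X^(pent j) * b * u) ((-1) ^+ `|j|%N * 'X^(pent j)).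
Proof.
move=> bu; rewrite -!mulrA; apply: eqmodXMl.
case: (ltnP `|j| N) => [/bu {}bu | le_Nj].
  by rewrite -[X in eqmodX _ _ X]mulr1; apply: eqmodXMl.
have X0 : eqmodX N 'X^(pent j) 0 by apply: eqmodX_monom0; have := leq_pent j; lia.
apply: (eqmodX_trans _ (eqmodX_sym X0)).
by rewrite -(mul0r (b * u)); apply: eqmodXM X0 (eqmodX_refl _ _).
Qed.

Lemma eqmodX_schur_sum N :
  eqmodX N (schur_sum 'X (2 * N) (10 * N) * qfact 'X N) (pent_sum (2 * N)).
Proof.
rewrite /schur_sum mulr_suml; apply: eqmodX_sum => i.
set j := (_ - _ : int); apply: eqmodX_pent_term => lt_jN.
(* For |j| < N the index differs from 5N by at most 5N/2, hence stays at distance at least N from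
   both ends of row 10N. *)
have [k [m [-> -> leN1 leN2]]] : exists k m : nat,
    [/\ schur_index (10 * N) j = k, (10 * N = k + m)%N, (N <= k)%N & (N <= m)%N].
  exists `|schur_index (10 * N) j|%N, (10 * N - `|schur_index (10 * N) j|)%N.
  by rewrite /schur_index; split; lia.
by rewrite qbinz_nat -['X]expr1; apply: eqmodX_qbin.
Qed.

Lemma eqmodX_triple N :
  eqmodX N ((\prod_(i < 2 * N) ((1 - 'X^(5 * i + 1)) * (1 - 'X^(5 * i + 4)))) *
            qfact 'X^5 N) (pent_sum (2 * N)).
Proof.
rewrite triple_product ?polyX_eq0 // mulr_suml; apply: eqmodX_sum => i.
set j := (_ - _ : int); have lt_i := ltn_ord i.
apply: eqmodX_pent_term => lt_jN.
have Ei : (2 * (2 * N) = i + (2 * (2 * N) - i))%N by lia.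
rewrite /j in lt_jN; rewrite [X in qbin _ X]Ei.
by apply: eqmodX_qbin; lia.
Qed.

Lemma qfact_mod5 (R : comNzRingType) (q : R) m : qfact q (5 * m) =
  (\prod_(i < m) ((1 - q ^+ (5 * i + 1)) * (1 - q ^+ (5 * i + 4)))) *
  (\prod_(i < m) ((1 - q ^+ (5 * i + 2)) * (1 - q ^+ (5 * i + 3)))) *
  qfact (q ^+ 5) m.
Proof.
elim: m => [|m IHm]; first by rewrite muln0 /qfact !big_ord0 !mulr1.
rewrite mulnS (_ : 5 + 5 * m = (5 * m).+1.+4)%N //.
rewrite !qfactS IHm !big_ord_recr /= -exprM mulnS.
rewrite !addnS !addn0 !addSn add0n.
by ring.
Qed.

Definition prod23 m : {poly rat} :=
  \prod_(i < m) ((1 - 'X^(5 * i + 2)) * (1 - 'X^(5 * i + 3))).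

(** Multiplied by [P14] and (X^5; X^5)_N, both sides become [pent_sum (2 * N)]: the right one by the
    triple product, the left one because [prod23] completes these factors to (X; X)_(10N), which is
    (X; X)_N modulo X^N. *)
Theorem rogers_ramanujan_poly N :
  eqmodX N (schur_sum 'X (2 * N) (10 * N) * prod23 (2 * N)) 1.
Proof.
have coef0 n : ('X^(n.+1) : {poly rat}).[0] = 0 by rewrite hornerXn expr0n.
set P14 := \prod_(i < 2 * N) ((1 - 'X^(5 * i + 1)) * (1 - 'X^(5 * i + 4))) : {poly rat}.
apply: (@eqmodX_cancel N (P14 * qfact 'X^5 N)).
  rewrite hornerM mulf_neq0 ?qfact_X0 ?oner_eq0 // horner_prod.
  apply/prodf_neq0 => i _.
  by rewrite !hornerE !addnS !expr0n !subr0 mul1r oner_eq0.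
rewrite mulr1; apply: (eqmodX_trans _ (eqmodX_sym (eqmodX_triple N))).
apply: (eqmodX_trans _ (eqmodX_schur_sum N)).
rewrite mulrCA; apply: eqmodXMl; rewrite mulrAC.
apply: (@eqmodX_trans _ (qfact 'X^1 (10 * N))); last by apply: eqmodX_qfact => //; lia.
have -> : (10 * N = 5 * (2 * N))%N by lia.
rewrite qfact_mod5 expr1; apply: eqmodXMl.
apply: eqmodX_sym; apply: eqmodX_qfact => //; lia.
Qed.

(** * Generating polynomials of integer partitions *)

Lemma eqmodX_from_coef N (p r : {poly rat}) :
  (forall i, (i < N)%N -> p`_i = r`_i) -> eqmodX N p r.
Proof.
move=> pr; rewrite /eqmodX -(poly_take_drop N (p - r)).
rewrite (_ : take_poly N (p - r) = 0) ?add0r ?dvdp_mull //.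
apply/polyP => i; rewrite coef_take_poly coef0; case: ifP => // lt_iN.
by rewrite coefB pr // subrr.
Qed.

Definition is_partition (n : nat) (s : seq nat) : bool :=
  [&& sorted geq s, 0%N \notin s & sumn s == n].

Fixpoint seqs_upto (n m : nat) : seq (seq nat) :=
  if m is m'.+1 then
    [::] :: [seq x :: s | x <- iota 0 n.+1, s <- seqs_upto n m']
  else [:: [::]].

(** Duplicate-free, so that [count] gives the number of partitions and [index] can be inverted. *)
Definition partitions (n : nat) : seq (seq nat) :=
  undup [seq s <- seqs_upto n n | is_partition n s].

Lemma mem_seqs_upto n m s :
  (size s <= m)%N -> all (leq^~ n) s -> s \in seqs_upto n m.
Proof.
elim: m s => [|m IHm] [|x s] // lt_sm /andP[le_xn le_sn].
rewrite -[seqs_upto n m.+1]/([::] :: [seq y :: t | y <- iota 0 n.+1, t <- seqs_upto n m]).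
rewrite in_cons; apply/allpairsPdep; exists x, s; split => //.
  by rewrite mem_iota add0n ltnS.
exact: IHm.
Qed.

Lemma leq_sumn s x : x \in s -> (x <= sumn s)%N.
Proof.
elim: s => //= y s IHs; rewrite in_cons => /predU1P[-> | /IHs]; lia.
Qed.

Lemma size_leq_sumn s : 0%N \notin s -> (size s <= sumn s)%N.
Proof. by elim: s => //= y s IHs; rewrite in_cons negb_or => /andP[? /IHs]; lia. Qed.

Lemma mem_partitions n s : (s \in partitions n) = is_partition n s.
Proof.
rewrite mem_undup mem_filter andb_idr // => /and3P[_ s_pos /eqP<-].
by apply: mem_seqs_upto; [apply: size_leq_sumn | apply/allP => x /leq_sumn].
Qed.

Section GeneratingFunction.
Variable N : nat.
Implicit Types P : pred (seq nat).

Definition genpoly P : {poly rat} := \poly_(n < N) (count P (partitions n))%:R.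

(** Common scheme of both recurrences: a partition in [P1] but not in [P0] starts with its largest
    part k, and deleting it leaves a partition of n - k in [P']. *)
Lemma count_partitions_rec P1 P0 P' k n : (0 < k)%N ->
  (forall s, sorted geq s -> P1 s = P0 s || (if s is x :: t then (x == k) && P' t else
    false)) ->
  (forall t, ~~ P0 (k :: t)) -> (forall t, P' t -> all (leq^~ k) t) ->
  count P1 (partitions n) =
  (count P0 (partitions n) + (if k <= n then count P' (partitions (n - k)) else 0))%N.
Proof.
move=> k_gt0 P1E P0k P'k.
have -> : (if k <= n then count P' (partitions (n - k)) else 0)%N =
  size (if (k <= n)%N then [seq k :: t | t <- partitions (n - k) & P' t] else [::]).
  by case: ifP => // _; rewrite size_map size_filter.
rewrite -!size_filter -size_cat; apply: perm_size; apply: uniq_perm.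
- by rewrite filter_uniq // undup_uniq.
- rewrite cat_uniq filter_uniq ?undup_uniq //=; apply/andP; split.
    apply/hasPn => s; case: ifP => // _ /mapP[t _ ->].
    by rewrite mem_filter (negbTE (P0k t)).
  case: ifP => // _; rewrite map_inj_uniq => [|x y [] //].
  by rewrite filter_uniq // undup_uniq.
move=> s; rewrite mem_cat !mem_filter mem_partitions.
have -> : (s \in (if (k <= n)%N then [seq k :: t | t <- partitions (n - k) & P' t] else
  [::])) =
  (if s is x :: t then (x == k) && P' t else false) && is_partition n s.
  apply/idP/idP => [|].
    case: ifP => // le_kn /mapP[t]; rewrite mem_filter mem_partitions => /andP[P't].
    move=> /and3P[t_sorted t_pos /eqP sum_t] ->; rewrite eqxx P't /=.
    rewrite /is_partition /= path_sortedE; last by move=> a b c /=; lia.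
    rewrite t_sorted in_cons negb_or t_pos sum_t (eq_sym 0%N) -lt0n k_gt0 andbT.
    by rewrite (P'k t P't) /=; apply/eqP; lia.
  case: s => // x t /andP[/andP[/eqP-> P't]]; rewrite /is_partition /=.
  rewrite in_cons negb_or => /and3P[/path_sorted t_sorted /andP[_ t_pos] /eqP sum_t].
  have -> : (k <= n)%N by lia.
  apply: map_f; rewrite mem_filter P't mem_partitions /is_partition t_sorted t_pos.
  by apply/eqP; lia.
by rewrite -andb_orl; case: (boolP (is_partition n s)) => [/and3P[/P1E-> _ _]|];
  rewrite ?andbF.
Qed.

Lemma genpoly_rec P1 P0 P' k : (0 < k)%N ->
  (forall s, sorted geq s -> P1 s = P0 s || (if s is x :: t then (x == k) && P' t else
    false)) ->
  (forall t, ~~ P0 (k :: t)) -> (forall t, P' t -> all (leq^~ k) t) ->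
  eqmodX N (genpoly P1) (genpoly P0 + 'X^k * genpoly P').
Proof.
move=> k_gt0 P1E P0k P'k; apply: eqmodX_from_coef => i lt_iN.
rewrite coefD coefXnM !coef_poly lt_iN (count_partitions_rec _ k_gt0 P1E P0k P'k).
rewrite natrD; case: (leqP k i) => // le_ki.
by rewrite (leq_ltn_trans (leq_subr _ _) lt_iN).
Qed.

Lemma genpoly_nil P : (0 < N)%N -> (forall s, 0%N \notin s -> P s = (s == [::])) ->
  genpoly P = 1.
Proof.
move=> N_gt0 PE; apply/polyP => i; rewrite coef_poly coef1.
case: ltnP => [lt_iN | ]; last by case: i => //; rewrite leqNgt N_gt0.
have -> : count P (partitions i) = (i == 0)%N.
  case: i lt_iN => [|i] _.
    by rewrite /partitions /= PE.
  apply/eqP; rewrite -[_ == _]negbK -lt0n -has_count; apply/hasPn => s.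
  rewrite mem_partitions => /and3P[_ s_pos /eqP sum_s]; rewrite PE //.
  by apply/eqP => s0; rewrite s0 in sum_s.
by [].
Qed.

Lemma eq_genpoly P P' : P =1 P' -> genpoly P = genpoly P'.
Proof. by move=> PP'; apply/polyP => i; rewrite !coef_poly (eq_count PP'). Qed.

Definition mod5_23 (x : nat) : bool := (x %% 5 == 2)%N || (x %% 5 == 3)%N.

Definition mod5_le (k : nat) : pred (seq nat) :=
  all (fun x => mod5_23 x && (x <= k)%N).

Definition gap2 : rel nat := fun x y => (y + 2 <= x)%N.

Definition gap2_le (k : nat) : pred (seq nat) :=
  fun s => all (fun x => (2 <= x <= k)%N) s && sorted gap2 s.

Lemma mod5_leS k : ~~ mod5_23 k.+1 -> mod5_le k.+1 =1 mod5_le k.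
Proof.
move=> nk s; apply: eq_all => x; rewrite leq_eqVlt ltnS.
by case: eqP => [->|//]; rewrite (negbTE nk).
Qed.

(** Parts may repeat, so deleting one part k + 1 stays within the class: G = H + X^(k+1) G. *)
Lemma genpoly_mod5S k : mod5_23 k.+1 ->
  eqmodX N (genpoly (mod5_le k.+1) * (1 - 'X^(k.+1))) (genpoly (mod5_le k)).
Proof.
move=> k23; set G := genpoly _; set H := genpoly _.
have : eqmodX N G (H + 'X^(k.+1) * G).
  apply: genpoly_rec => // [[|x t]||] //.
  - move=> /= xt; rewrite /mod5_le /=.
    have {}xt : all (geq x) t.
      by move: xt; rewrite path_sortedE => [/andP[]|a b c /=]; [|lia].
    rewrite leq_eqVlt ltnS; case: eqP => [->|_] /=; last first.
      rewrite orbF; case: (leqP x k) => le_xk; rewrite ?andbF //; congr (_ && _).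
      apply: eq_in_all => y /(allP xt) /= le_yx.
      by rewrite (leq_trans le_yx le_xk) (leq_trans le_yx (leqW le_xk)).
    by rewrite k23 ltnn /=.
  - by move=> t; rewrite /mod5_le /= ltnn andbF.
  - by move=> t; apply: sub_all => x /andP[].
rewrite /eqmodX opprD addrA => GH.
by rewrite mulrBr mulr1 addrAC [G * _]mulrC.
Qed.

Lemma genpoly_mod5 m : (0 < N)%N ->
  eqmodX N (genpoly (mod5_le (5 * m)) * prod23 m) 1.
Proof.
move=> N_gt0; elim: m => [|m IHm].
  rewrite muln0 /prod23 big_ord0 mulr1 genpoly_nil //; first exact: eqmodX_refl.
  case=> // x s; rewrite in_cons negb_or => /andP[x_neq0 _].
  by rewrite /mod5_le /= leqn0 eq_sym (negbTE x_neq0) andbF.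
apply: (eqmodX_trans _ IHm).
rewrite /prod23 big_ord_recr /= -/(prod23 m) mulrCA [X in eqmodX _ _ X]mulrC.
apply: eqmodXMl; rewrite mulrA.
(* Of the five new part sizes, 5m + 1, 5m + 4 and 5m + 5 add nothing, while 5m + 2 and 5m + 3
   account for the two new factors of [prod23]. *)
rewrite (_ : 5 * m.+1 = (5 * m).+1.+4)%N; last by lia.
rewrite (eq_genpoly (mod5_leS _)); last by rewrite /mod5_23; lia.
rewrite (eq_genpoly (mod5_leS _)); last by rewrite /mod5_23; lia.
rewrite mulrAC !addnS addn0 -(eq_genpoly (mod5_leS (k := 5 * m) _));
  last by rewrite /mod5_23; lia.
apply: (@eqmodX_trans _ (genpoly (mod5_le (5 * m).+2) * (1 - 'X^((5 * m).+2)))).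
  by apply: eqmodXM (eqmodX_refl _ _); apply: genpoly_mod5S; rewrite /mod5_23; lia.
by apply: genpoly_mod5S; rewrite /mod5_23; lia.
Qed.

(** A largest part k + 2 forces the remaining parts to be at most k. *)
Lemma genpoly_gap2 k : eqmodX N (genpoly (gap2_le k.+2))
  (genpoly (gap2_le k.+1) + 'X^(k.+2) * genpoly (gap2_le k)).
Proof.
have gap2_trans : transitive gap2 by rewrite /gap2 => a b c; lia.
apply: genpoly_rec => // [[|x t]||] //.
- move=> /= xt; rewrite /gap2_le /= !path_sortedE //.
  case: (eqVneq x k.+2) => [->|neq_x] /=.
    rewrite ltnn leqnn /= -[RHS]/(_ && _).
    case: (sorted gap2 t); rewrite ?andbF ?andbT //.
    rewrite -all_predI; apply: eq_all => y /=; rewrite /gap2; lia.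
  have {}xt : all (geq x) t.
    by move: xt; rewrite path_sortedE => [/andP[]|a b c /=]; [|lia].
  rewrite orbF; congr (_ && _).
  rewrite (_ : (x <= k.+2)%N = (x <= k.+1)%N); last by lia.
  case: (leqP x k.+1) => le_x; rewrite ?andbF //; congr (_ && _).
  by apply: eq_in_all => y /(allP xt) /=; lia.
- by move=> t; rewrite /gap2_le /= ltnn.
- by move=> t /andP[+ _]; apply: sub_all => x; lia.
Qed.

Lemma genpoly_gap2_schur M k : (0 < N)%N -> (k <= 5 * M)%N ->
  eqmodX N (genpoly (gap2_le k)) (schur_sum 'X M k.+1).
Proof.
move=> N_gt0.
have base i : (i < 2)%N -> genpoly (gap2_le i) = 1.
  move=> lt_i2; apply: genpoly_nil => // -[|x s] // _.
  by rewrite /gap2_le /= (_ : (1 < x <= i)%N = false) //; lia.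
(* Two consecutive cases are carried along, as the recurrence has order two. *)
suff: (k <= 5 * M)%N -> eqmodX N (genpoly (gap2_le k)) (schur_sum 'X M k.+1) /\
   ((k.+1 <= 5 * M)%N -> eqmodX N (genpoly (gap2_le k.+1)) (schur_sum 'X M k.+2)).
  by move=> H /H [].
elim: k => [|k IHk] le_k.
  rewrite !base // schur_sum_rec ?schur_sum0 ?schur_sum1 ?mulr0 ?addr0 //.
  by split => *; apply: eqmodX_refl.
have [IH1 /(_ le_k) IH2] := IHk (ltnW le_k); split => // lt_k.
rewrite schur_sum_rec //; apply: (eqmodX_trans (genpoly_gap2 _)).
by apply: eqmodXD => //; apply: eqmodXMl.
Qed.

End GeneratingFunction.

(** The bound 2 expresses the absence of primitive parts: among the multiples i t of a primitive t,
    only t itself is primitive. *)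
Definition gap2_parts (s : seq nat) : bool := all (leq 2) s && sorted gap2 s.

Theorem rogers_ramanujan n :
  count (all mod5_23) (partitions n) = count gap2_parts (partitions n).
Proof.
(* Reading off the coefficient of X^n needs N > n. Row k + 1 = 10N is that of
   [rogers_ramanujan_poly], and the bounds 10N and k on the parts are void for partitions of n. *)
pose N := n.+1; pose k := (10 * N).-1.
have boundE P Q : (forall s, all (leq^~ n) s -> P s = Q s) ->
    count P (partitions n) = count Q (partitions n).
  move=> PQ; apply: eq_in_count => s; rewrite mem_partitions => /and3P[_ _ /eqP sum_s].
  by apply: PQ; apply/allP => x /leq_sumn; rewrite sum_s.
have -> : count (all mod5_23) (partitions n) = count (mod5_le (5 * (2 * N))) (partitions n).
  apply: boundE => s /allP le_s; apply: eq_in_all => x /le_s le_x.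
  by rewrite (_ : x <= _)%N ?andbT // /N; lia.
have -> : count gap2_parts (partitions n) = count (gap2_le k) (partitions n).
  apply: boundE => s /allP le_s; congr (_ && _); apply: eq_in_all => x /le_s le_x.
  by rewrite (_ : x <= _)%N ?andbT // /k /N; lia.
have EA := @genpoly_mod5 N (2 * N) isT.
have EB : eqmodX N (genpoly N (gap2_le k) * prod23 (2 * N)) 1.
  apply: (eqmodX_trans _ (rogers_ramanujan_poly N)).
  apply: eqmodXM (eqmodX_refl _ _).
  have -> : (10 * N = k.+1)%N by rewrite /k /N; lia.
  by apply: genpoly_gap2_schur => //; rewrite /k /N; lia.
have : eqmodX N (genpoly N (mod5_le (5 * (2 * N)))) (genpoly N (gap2_le k)).
  apply: (@eqmodX_cancel N (prod23 (2 * N))).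
    rewrite horner_prod; apply/prodf_neq0 => i _.
    by rewrite !hornerE !addnS !expr0n !subr0 mul1r oner_eq0.
  by rewrite ![prod23 _ * _]mulrC; apply: eqmodX_trans EA (eqmodX_sym EB).
move/(eqmodX_coef (ltnSn n)); rewrite !coef_poly ltnSn => /eqP.
by rewrite eqr_nat => /eqP.
Qed.

(** * Scale and primitive factor *)

(** By the primitive element theorem K = Q(z). If w is a root in [algC] of the minimal polynomial of
    z, the embedding sends p(z) to p(w). *)
Lemma complex_embedding (K : fieldExtType rat) : {f : {rmorphism K -> algC} | True}.
Proof.
have [z Dz] : {z : K | <<1; z>>%VS = fullv}.
  exists (separable_generator 1 {:K}).
  rewrite -eq_adjoin_separable_generator ?sub1v //.
  apply/separableP => y _; apply: pcharf0_separable => p.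
  by rewrite (fmorph_pchar (in_alg K)) pchar_num.
pose pK := map_poly (in_alg K); pose pC := map_poly (ratr : rat -> algC).
have polyz v : {p | v = (pK p).[z]}.
  apply: cid; have : v \in <<1; z>>%VS by rewrite Dz memvf.
  by case/Fadjoin_polyP => _ /polyOver1P[p ->] ->; exists p.
have /polyOver1P/cid[q Dq] := minPolyOver 1 z.
have [w q_w] : {w | root (pC q) w}.
  apply: cid; apply/closed_rootP.
  by rewrite size_map_poly -(size_map_poly (in_alg K)) -Dq size_minPoly.
(* The map is well defined: polynomials with the same value at z differ by a multiple of q, which
   vanishes at w. *)
have pK_pC p r : (pK p).[z] = (pK r).[z] -> (pC p).[w] = (pC r).[w].
  move=> eq_pr; apply/eqP; rewrite -subr_eq0 -hornerN -hornerD -rmorphB /= -/(root _ _).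
  have : q %| p - r.
    rewrite -(dvdp_map (in_alg K)) -Dq minPoly_dvdp //; first by apply/polyOver1P;
      exists (p - r).
    by rewrite /root rmorphB hornerD hornerN eq_pr subrr.
  by rewrite -(@dvdp_map _ algC ratr) => /dvdpP[s ->]; rewrite rootM q_w orbT.
pose g v := (pC (sval (polyz v))).[w].
have gE p v : v = (pK p).[z] -> g v = (pC p).[w].
  by rewrite /g; case: (polyz v) => r /= -> /pK_pC.
have g_add : zmod_morphism g.
  move=> u v; rewrite /g; case: (polyz u) => p /= Dp; case: (polyz v) => r /= Dr.
  rewrite -/(g _) (gE (p - r)) /pC ?rmorphB ?hornerD ?hornerN //.
  by rewrite Dp Dr /pK rmorphB hornerD hornerN.
have g_mul : monoid_morphism g.
  split; first by rewrite (@gE 1) /pC /pK rmorph1 hornerC.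
  move=> u v; rewrite /g; case: (polyz u) => p /= Dp; case: (polyz v) => r /= Dr.
  rewrite -/(g _) (gE (p * r)) /pC ?rmorphM ?hornerM //.
  by rewrite Dp Dr /pK rmorphM hornerM.
pose gA := GRing.isZmodMorphism.Build _ _ g g_add.
pose gM := GRing.isMonoidMorphism.Build _ _ g g_mul.
pose f : {rmorphism K -> algC} := HB.pack g gA gM.
by exists f.
Qed.

Section Scale.
Variable K : fieldExtType rat.
Implicit Types (x y t : K) (n : nat).
Local Notation integral := (@algebraic_integer K).

Lemma embedding_Aint (f : {rmorphism K -> algC}) x : integral x -> f x \in Aint.
Proof.
case=> p p_monic px0; apply: (@root_monic_Aint (map_poly intr p)).
- have -> : map_poly intr p = map_poly f (map_poly intr p).
    by rewrite -map_poly_comp; apply: eq_map_poly => a /=; rewrite rmorph_int.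
  by rewrite fmorph_root.
- by rewrite monic_map.
- by apply/polyOverP => i; rewrite coef_map /= intr_int.
Qed.

Lemma Oplus_neq0 x : Oplus x -> x != 0.
Proof.
have [f _] := complex_embedding K; case=> _ /(_ f) fx_gt0.
by apply: contraTneq fx_gt0 => ->; rewrite rmorph0 ltxx.
Qed.

Lemma natr_neq0 n : (0 < n)%N -> n%:R != 0 :> K.
Proof.
by rewrite -(rmorph_nat (in_alg K)) fmorph_eq0 pnatr_eq0 lt0n.
Qed.

Lemma OplusMn n x : (0 < n)%N -> Oplus x -> Oplus (n%:R * x).
Proof.
move=> n_gt0 [x_int x_pos]; split; first exact/integral_mul/x_int/integral_nat.
by move=> f; rewrite rmorphM rmorph_nat mulr_gt0 ?ltr0n // x_pos.
Qed.

Lemma Oplus_integral n x : (0 < n)%N -> Oplus (n%:R * x) -> integral x -> Oplus x.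
Proof.
move=> n_gt0 [_ x_pos] x_int; split=> // f; have := x_pos f.
by rewrite rmorphM rmorph_nat pmulr_rgt0 ?ltr0n.
Qed.

(* If [x * q.[x] = - c] with [c] a nonzero integer and [x = n y], then
   [c / n = - y * q.[x]] is a rational algebraic integer. *)
Lemma integral_divisors x : integral x -> x != 0 ->
  exists2 c : nat, (0 < c)%N & forall n y, integral y -> x = n%:R * y -> (n %| c)%N.
Proof.
move=> x_int x_neq0; have [p p_monic px0] := x_int.
(* Splitting off the power of X in p leaves a factor q with nonzero constant term, which still
   vanishes at the nonzero x. *)
have [m [q]] := multiplicity_XsubC p 0.
rewrite monic_neq0 //= => q0 Dp.
have qx0 : (map_poly intr q).[x] = 0.
  move: px0; rewrite Dp rmorphM rmorphXn /= map_polyXsubC rootM.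
  case/orP => [/rootP //|]; case: m {Dp} => [|m]; first by rewrite expr0 (negbTE (root1 x)).
  by rewrite root_exp_XsubC rmorph0 (negbTE x_neq0).
have {}q0 : q`_0 != 0 by rewrite -horner_coef0.
exists (absz q`_0) => [|n y y_int Dx]; first by rewrite absz_gt0.
have n_neq0 : n != 0%N.
  by apply: contraNneq x_neq0 => n0; rewrite Dx n0 mul0r.
pose q1 := drop_poly 1 q.
have Dq : q = (q`_0)%:P + q1 * 'X.
  by rewrite -[LHS](poly_take_drop 1) expr1; congr (_ + _); apply/polyP => -[|i];
     rewrite coef_take_poly coefC.
pose u : K := y * (map_poly intr q1).[x].
have u_int : integral u.
  apply: integral_mul => //; apply: integral_horner x_int.
  by apply/integral_poly => i; rewrite coef_map; apply: integral_id.
have Du : n%:R * u = - (q`_0)%:~R.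
  apply/eqP; rewrite -addr_eq0 addrC mulrA -Dx mulrC -qx0 {2}Dq.
  by rewrite rmorphD rmorphM /= map_polyC map_polyX hornerD hornerC hornerMX.
have [f _] := complex_embedding K.
have Dfu : f u = - (q`_0)%:~R / n%:R.
  apply: (canRL (mulfK _)); first by rewrite pnatr_eq0.
  by rewrite mulrC -(rmorph_nat f) -rmorphM Du rmorphN rmorph_int.
have /intrP[z Dz] : f u \in Num.int.
  apply: Cint_rat_Aint (embedding_Aint f u_int).
  by rewrite Dfu rpred_div ?rpredN ?rpred_int ?rpred_nat.
have : (- q`_0)%:~R = (n%:Z * z)%:~R :> algC.
  by rewrite rmorphM /= -Dz Dfu rmorphN /= mulrC divfK ?pnatr_eq0.
move/intr_inj => E; rewrite -abszN E abszM; exact: dvdn_mulr.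
Qed.

(** The integers n dividing x within O+ are bounded, and the largest one leaves a primitive
    quotient. *)
Lemma scale_exists x : Oplus x ->
  exists p : nat * K, [/\ (0 < p.1)%N, primitive p.2 & x = p.1%:R * p.2].
Proof.
move=> Ox; have [c c_gt0 c_div] := integral_divisors Ox.1 (Oplus_neq0 Ox).
pose P n := `[< (0 < n)%N /\ exists2 y, Oplus y & x = n%:R * y >].
have exP : exists n, P n by exists 1%N; apply/asboolP; split => //; exists x; rewrite ?mul1r.
have leP n : P n -> (n <= c)%N.
  by move/asboolP => [_ [y [y_int _] Dx]]; apply: dvdn_leq (c_div n y _ _).
have [n /asboolP[n_gt0 [y Oy Dx]] max_n] := ex_maxnP exP leP.
exists (n, y); split => //=; split => // m m_gt1 [z Oz Dy].
have /max_n : P (n * m)%N.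
  apply/asboolP; split; first by rewrite muln_gt0 n_gt0; lia.
  by exists z => //; rewrite natrM -mulrA -Dy.
by apply/negP; rewrite -ltnNge; nia.
Qed.

(** Let g = gcd(n, n') = km n - kn n' and b = n' / g. Then t = b (km t' - kn t), and primitivity of
    t forces b = 1. *)
Lemma primitive_dvd n n' t t' : (0 < n)%N -> (0 < n')%N ->
  primitive t -> Oplus t' -> n%:R * t = n'%:R * t' -> (n' %| n)%N.
Proof.
move=> n_gt0 n'_gt0 [Ot t_prim] Ot' E.
have [km kn Dk _] := egcdnP n' n_gt0.
have /dvdnP[b Dn'] := dvdn_gcdr n n'.
pose y := km%:R * t' - kn%:R * t.
have y_int : integral y.
  by apply: integral_sub; apply: integral_mul;
    do ?[exact: integral_nat | exact: Ot'.1 | exact: Ot.1].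
have g_gt0 : (0 < gcdn n n')%N by rewrite gcdn_gt0 n_gt0.
have b_gt0 : (0 < b)%N by case: b Dn' n'_gt0 => // ->.
have Dt : t = b%:R * y.
  have Dg : (gcdn n n')%:R = km%:R * n%:R - kn%:R * n'%:R :> K.
    by rewrite -!natrM Dk natrD addrAC subrr add0r.
  apply: (mulfI (natr_neq0 g_gt0)); rewrite mulrA -natrM mulnC -Dn' Dg mulrBl -!mulrA E /y.
  by ring.
have Oy : Oplus y by apply: (Oplus_integral b_gt0) => //; rewrite -Dt.
have b1 : b = 1%N.
  apply/eqP; rewrite eqn_leq b_gt0 andbT leqNgt; apply/negP => b_gt1.
  by apply: t_prim b_gt1 _; exists y.
by rewrite Dn' b1 mul1n dvdn_gcdl.
Qed.

Lemma scaleP x : Oplus x ->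
  [/\ (0 < scale x)%N, primitive (primitive_factor x) &
       x = (scale x)%:R * primitive_factor x].
Proof.
move/scale_exists => [p xp].
by have := @xgetPex _ (0%N, 0)
  [set p : nat * K | [/\ (0 < p.1)%N, primitive p.2 & x = p.1%:R * p.2]]%classic
  (ex_intro _ p xp).
Qed.

(** Uniqueness of the decomposition: by [primitive_dvd] in both directions, two scales of the same
    element divide each other. *)
Lemma scaleMn n t : (0 < n)%N -> primitive t ->
  scale (n%:R * t) = n /\ primitive_factor (n%:R * t) = t.
Proof.
move=> n_gt0 t_prim; have Ot := t_prim.1.
have [s_gt0 f_prim E] := scaleP (OplusMn n_gt0 Ot).
move: (scale _) (primitive_factor _) s_gt0 f_prim E => m u m_gt0 u_prim E.
have Enm : n = m.
  apply/eqP; rewrite eqn_dvd (primitive_dvd m_gt0 n_gt0 u_prim Ot (esym E)).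
  by rewrite (primitive_dvd n_gt0 m_gt0 t_prim u_prim.1 E).
by split=> //; apply: (mulfI (natr_neq0 n_gt0)); rewrite E Enm.
Qed.

End Scale.

(** * Transport of bijections to sections *)

(** Partitions of the same integer are matched by their rank in the two filtered lists, so that
    exchanging [P] and [Q] gives the inverse when the counts agree. *)
Definition transfer (P Q : pred (seq nat)) (s : seq nat) : seq nat :=
  nth [::] [seq u <- partitions (sumn s) | Q u]
    (index s [seq u <- partitions (sumn s) | P u]).

Lemma transferP (P Q : pred (seq nat)) n s :
  count P (partitions n) = count Q (partitions n) -> is_partition n s -> P s ->
  [/\ is_partition n (transfer P Q s), Q (transfer P Q s) &
      transfer Q P (transfer P Q s) = s].
Proof.
move=> PQ s_part Ps; have /and3P[_ _ /eqP Dn] := s_part.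
have s_in : s \in [seq u <- partitions n | P u] by rewrite mem_filter Ps mem_partitions.
have lt_i : (index s [seq u <- partitions n | P u] < size [seq u <- partitions n | Q u])%N.
  by rewrite size_filter -PQ -size_filter index_mem.
have Du : transfer P Q s = nth [::] [seq u <- partitions n | Q u]
    (index s [seq u <- partitions n | P u]) by rewrite /transfer Dn.
move: (transfer P Q s) Du => u Du.
have : u \in [seq u <- partitions n | Q u] by rewrite Du mem_nth.
rewrite mem_filter mem_partitions => /andP[Qu u_part]; split => //.
have /and3P[_ _ /eqP sum_u] := u_part.
by rewrite /transfer sum_u Du index_uniq ?nth_index // filter_uniq // undup_uniq.
Qed.

Lemma flatten_if_eq (T : eqType) (S : Type) (f : T -> seq S) a (s : seq T) : uniq s ->
  flatten [seq if x == a then f x else [::] | x <- s] = if a \in s then f a else [::].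
Proof.
elim: s => //= x s IHs /andP[x_s /IHs ->]; rewrite in_cons eq_sym.
by case: eqP => [->|] //=; rewrite (negbTE x_s) cats0.
Qed.

Section Lift.
Variable K : fieldExtType rat.
Implicit Types (m : {mset K}) (t x y : K).

Definition Omset m : Prop := forall x, x \in enum_mset m -> Oplus x.

Definition sect t m : seq nat :=
  sort geq [seq scale x | x <- enum_mset m & primitive_factor x == t].

Definition lift_seq (Phi : seq nat -> seq nat) m : seq K :=
  flatten [seq [seq i%:R * t | i <- Phi (sect t m)]
          | t <- undup [seq primitive_factor x | x <- enum_mset m]].

Definition lift Phi m : {mset K} := seq_mset (lift_seq Phi m).

Lemma geq_trans : transitive geq.
Proof. by move=> a b c /= ab bc; apply: leq_trans bc ab. Qed.

Lemma geq_total : total geq.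
Proof. by move=> a b; apply: leq_total. Qed.

Lemma sorted_sect t m : sorted geq (sect t m).
Proof. exact: sort_sorted geq_total _. Qed.

Lemma mem_sect t m i : Omset m ->
  reflect (exists2 x, x \in enum_mset m & primitive_factor x = t /\ scale x = i) (i \in sect
    t m).
Proof.
move=> Om; rewrite mem_sort; apply: (iffP mapP) => [[x]|[x xm [pfx <-]]].
  by rewrite mem_filter => /andP[/eqP pfx xm] ->; exists x.
by exists x => //; rewrite mem_filter pfx eqxx.
Qed.

Lemma partition_sect t m : Omset m -> is_partition (sumn (sect t m)) (sect t m).
Proof.
move=> Om; rewrite /is_partition sorted_sect eqxx andbT /=.
by apply/mem_sect => // -[x /Om/scaleP[s_gt0 _ _] [_ s0]]; rewrite s0 in s_gt0.
Qed.

Lemma count_sect m x : Omset m -> Oplus x ->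
  m x = count_mem (scale x) (sect (primitive_factor x) m).
Proof.
move=> Om /scaleP[_ _ Dx]; rewrite -count_mem_mset /sect.
rewrite (permP (permEl (perm_sort _ _))) count_map count_filter.
apply: eq_in_count => y /Om/scaleP[_ _ Dy] /=.
apply/eqP/andP => [->|[/eqP sy /eqP py]]; first by rewrite !eqxx.
by rewrite Dy Dx sy py.
Qed.

(** The multiplicity of x in O+ is that of its scale in its section, and elements outside O+ have
    multiplicity 0. *)
Lemma eq_mset_sect m m' : Omset m -> Omset m' ->
  (forall t, primitive t -> sect t m = sect t m') -> m = m'.
Proof.
move=> Om Om' eq_sect; apply/msetP => x.
have [Ox|nOx] := pselect (Oplus x).
  have [_ t_prim _] := scaleP Ox.
  by rewrite !count_sect // eq_sect.
have out (m1 : {mset K}) : Omset m1 -> m1 x = 0%N.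
  move=> Om1; rewrite -count_mem_mset; apply/count_memPn; apply/negP => /Om1.
  exact: nOx.
by rewrite !out.
Qed.

Section Transport.
Variables (Phi : seq nat -> seq nat) (m : {mset K}).
Hypothesis Om : Omset m.
Hypothesis Phi_part : forall t, primitive t ->
  is_partition (sumn (sect t m)) (Phi (sect t m)).

Let T := undup [seq primitive_factor x | x <- enum_mset m].

Lemma primitive_sections t : t \in T -> primitive t.
Proof. by rewrite mem_undup => /mapP[x /Om/scaleP[_ xp _] ->]. Qed.

Lemma Phi_gt0 t i : primitive t -> i \in Phi (sect t m) -> (0 < i)%N.
Proof.
by move=> /Phi_part/and3P[_ + _] ip; rewrite lt0n; apply: contraNneq => <-.
Qed.

Lemma Omset_lift : Omset (lift Phi m).
Proof.
move=> x; rewrite (perm_mem (perm_eq_seq_mset _)) => /flatten_mapP[t /primitive_sections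
  t_prim].
by case/mapP => i /(Phi_gt0 t_prim) i_gt0 ->; apply: OplusMn i_gt0 t_prim.1.
Qed.

Lemma sect_lift t : primitive t -> sect t (lift Phi m) = Phi (sect t m).
Proof.
move=> t_prim.
have Phi_sorted : sorted geq (Phi (sect t m)) by case/and3P: (Phi_part t_prim).
apply: (sorted_eq geq_trans) => //; first by move=> a b /= ab; apply/eqP;
  rewrite eqn_leq andbC.
  exact: sorted_sect.
rewrite perm_sort.
apply: (@perm_trans _ [seq scale x | x <- lift_seq Phi m & primitive_factor x == t]).
  by apply/perm_map/perm_filter/perm_eq_seq_mset.
rewrite /lift_seq filter_flatten map_flatten -!map_comp.
rewrite [X in flatten X](_ : _ = [seq if u == t then Phi (sect u m) else [::] | u <- T]);
  last first.
  apply/eq_in_map => u /primitive_sections u_prim /=.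
  have scaleM i : i \in Phi (sect u m) ->
      scale (i%:R * u) = i /\ primitive_factor (i%:R * u) = u.
    by move/(Phi_gt0 u_prim) => i_gt0; apply: scaleMn.
  rewrite filter_map -map_comp; case: eqP => [<-|neq_ut].
    rewrite (_ : filter _ _ = Phi (sect u m)).
      by apply: map_id_in => i /scaleM[].
    by apply/all_filterP/allP => i /scaleM[_ /= ->].
  rewrite (_ : filter _ _ = [::]) //; apply/eqP; rewrite -[_ == _]negbK -has_filter.
  by apply/hasPn => i /scaleM[_ /= ->]; apply/eqP.
rewrite flatten_if_eq ?undup_uniq //; case: ifP => // tT.
(* The section of t does not meet [m], so [Phi] must return a partition of 0, which is empty. *)
have sect0 : sect t m = [::].
  apply/nilP; rewrite /nilp -all_pred0; apply/allP => i /(mem_sect _ _ Om)[x xm [pfx _]].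
  by rewrite -[t]pfx mem_undup map_f in tT.
have := Phi_part t_prim; rewrite sect0 /= => /and3P[_ Phi_pos /eqP sum0].
by have := size_leq_sumn Phi_pos; rewrite sum0 leqn0 => /nilP ->.
Qed.

Lemma sum_lift_seq : \sum_(x <- lift_seq Phi m) x = \sum_(t <- T) (sumn (sect t m))%:R * t.
Proof.
rewrite /lift_seq big_flatten big_map /=; apply: eq_big_seq => t /primitive_sections t_prim.
have /and3P[_ _ /eqP <-] := Phi_part t_prim.
by rewrite big_map -mulr_suml sumnE natr_sum.
Qed.

End Transport.

Lemma sum_lift Phi m : Omset m ->
  (forall t, primitive t -> is_partition (sumn (sect t m)) (Phi (sect t m))) ->
  \sum_(x <- enum_mset (lift Phi m)) x = \sum_(x <- enum_mset m) x.
Proof.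
move=> Om Phi_part.
have id_part t : primitive t -> is_partition (sumn (sect t m)) (id (sect t m)).
  by move=> _; apply: partition_sect.
(* As [m] is its own lift by the identity, both sums are given by [sum_lift_seq], whose right-hand
   side does not involve [Phi]. *)
have Dm : lift id m = m.
  by apply: eq_mset_sect => //; [apply: Omset_lift | move=> t; apply: sect_lift].
rewrite -[in RHS]Dm /lift !(perm_big _ (perm_eq_seq_mset _)) /=.
by rewrite (sum_lift_seq Om Phi_part) (sum_lift_seq Om id_part).
Qed.

Definition sections_in (P : pred (seq nat)) m : Prop :=
  forall t, primitive t -> P (sect t m).

Lemma lift_transfer (P Q : pred (seq nat)) (d : K) m :
  (forall n, count P (partitions n) = count Q (partitions n)) ->
  partition_of d m -> sections_in P m ->
  [/\ partition_of d (lift (transfer P Q) m), sections_in Q (lift (transfer P Q) m) &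
      lift (transfer Q P) (lift (transfer P Q) m) = m].
Proof.
move=> PQ [Om sum_m] Pm; set m' := lift _ m.
have tr t (t_prim : primitive t) := transferP (PQ _) (partition_sect t Om) (Pm t t_prim).
have tr_part t : primitive t -> is_partition (sumn (sect t m)) (transfer P Q (sect t m)).
  by case/tr.
have Om' : Omset m' by apply: Omset_lift.
have sect' t : primitive t -> sect t m' = transfer P Q (sect t m) by apply: sect_lift.
have tr_part' t : primitive t -> is_partition (sumn (sect t m')) (transfer Q P (sect t m')).
  move=> t_prim; have [t_part _ trK] := tr t t_prim.
  rewrite sect' // trK; have /and3P[_ _ /eqP->] := t_part.
  exact: partition_sect.
split; first by split=> //; rewrite sum_lift.
  by move=> t t_prim; rewrite sect' //; case: (tr t t_prim).
apply: eq_mset_sect => //; first exact: Omset_lift.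
by move=> t t_prim; rewrite sect_lift // sect' //; case: (tr t t_prim).
Qed.

Lemma card_sections_in (P Q : pred (seq nat)) (d : K) :
  (forall n, count P (partitions n) = count Q (partitions n)) ->
  ([set m | partition_of d m /\ sections_in P m] #=
   [set m | partition_of d m /\ sections_in Q m])%classic%card.
Proof.
move=> PQ; have QP n := esym (PQ n).
pose A := [set m | partition_of d m /\ sections_in P m]%classic.
have imA : (lift (transfer P Q) @` A = [set m | partition_of d m /\ sections_in Q m])%classic.
  apply/seteqP; split=> [_ [m [dm Pm] <-]|m [dm Qm]] /=.
    by have [] := lift_transfer PQ dm Pm.
  have [dm' Pm' <-] := lift_transfer QP dm Qm.
  by exists (lift (transfer Q P) m).
rewrite card_eq_sym -imA; apply: inj_card_eq => m m' /set_mem[dm Pm] /set_mem[dm' Pm'] eq_l.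
have [_ _ <-] := lift_transfer PQ dm Pm; have [_ _ <-] := lift_transfer PQ dm' Pm'.
by rewrite eq_l.
Qed.

(** * The conditions on parts, read section by section *)

Lemma scales_2_or_3_sections m : Omset m ->
  scales_2_or_3_mod_5 m <-> sections_in (all mod5_23) m.
Proof.
move=> Om; split=> [m23 t t_prim | m23 x xm].
  apply/allP => i /(mem_sect _ _ Om)[x xm [_ <-]].
  by rewrite /mod5_23; case: (m23 x xm) => ->; rewrite ?orbT.
have [_ t_prim _] := scaleP (Om x xm).
have /(allP (m23 _ t_prim)) : scale x \in sect (primitive_factor x) m.
  by apply/mem_sect => //; exists x.
by case/orP => /eqP; [left | right].
Qed.

(** A form of the gap condition free of the order of the list, to be compared with a condition on
    arbitrary pairs of positions. *)
Definition separated (s : seq nat) : Prop :=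
  uniq s /\ {in s &, forall i j, i != j -> gap2 i j || gap2 j i}.

Lemma gap2_separated s : sorted geq s -> sorted gap2 s <-> separated s.
Proof.
have gap2_trans : transitive gap2 by rewrite /gap2 => a b c; lia.
move=> s_sorted; split.
  move=> s_gap; split.
    by apply: (sorted_uniq gap2_trans) => // a; rewrite /gap2; lia.
  move=> i j; elim: s s_gap {s_sorted} => //= x s IHs.
  rewrite path_sortedE // => /andP[/allP gx /IHs{}IHs]; rewrite !in_cons.
  case/predU1P => [->|i_s] /predU1P[->|j_s]; rewrite ?eqxx //.
  - by move=> _; rewrite gx.
  - by move=> _; rewrite gx ?orbT.
  - exact: IHs.
elim: s s_sorted => // x s IHs; rewrite /= !path_sortedE //; last exact: geq_trans.
case/andP=> /allP ge_x s_sorted [/andP[x_s s_uniq] sep].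
rewrite IHs // ?andbT; last first.
  by split=> // i j i_s j_s; apply: sep; rewrite in_cons ?i_s ?j_s orbT.
apply/allP => y y_s; have := ge_x y y_s; rewrite /= => le_yx.
have neq_xy : x != y by apply: contraNneq x_s => ->.
have := sep x y; rewrite !in_cons eqxx y_s orbT => /(_ isT isT neq_xy).
by rewrite /gap2; lia.
Qed.

Lemma gap2_sections m : Omset m ->
  no_primitive_part m /\ scales_differ_by_2 m <-> sections_in gap2_parts m.
Proof.
move=> Om; split.
  move=> [no_prim diff2] t t_prim; apply/andP; split.
    apply/allP => i /(mem_sect _ _ Om)[x xm [_ <-]].
    have [s_gt0 x_prim Dx] := scaleP (Om x xm).
    rewrite leqNgt; apply/negP => s_lt2; apply: (no_prim x xm).
    by rewrite Dx (_ : scale x = 1%N) ?mul1r //; lia.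
  apply/gap2_separated; first exact: sorted_sect.
  have sep x y : x \in enum_mset m -> y \in enum_mset m -> x != y ->
      primitive_factor x = primitive_factor y ->
      gap2 (scale x) (scale y) || gap2 (scale y) (scale x).
    move=> xm ym neq_xy eq_p.
    have := diff2 (index x (enum_mset m)) (index y (enum_mset m)).
    rewrite !index_mem !nth_index // => /(_ xm ym _ eq_p) gap_xy.
    have : 2 <= `|(scale x)%:Z - (scale y)%:Z|.
      apply: gap_xy => eq_i; move/eqP: neq_xy; apply.
      by rewrite -(nth_index 0 xm) eq_i nth_index.
    by rewrite /gap2; lia.
  (* Equal parts at two positions would lie in the same section with scale difference 0. *)
  have m_uniq : uniq (enum_mset m).
    apply/(uniqP 0) => a b; rewrite !inE => lt_a lt_b eq_ab.
    apply/eqP/negP => /negP/eqP neq_ab; have := diff2 a b lt_a lt_b neq_ab.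
    by rewrite eq_ab subrr => /(_ erefl).
  split; last first.
    move=> i j /(mem_sect _ _ Om)[x xm [px <-]] /(mem_sect _ _ Om)[y ym [py <-]] neq_s.
    by apply: sep => //; [apply: contraNneq neq_s => -> | rewrite px py].
  rewrite sort_uniq map_inj_in_uniq ?filter_uniq // => x y.
  rewrite !mem_filter => /andP[/eqP px xm] /andP[/eqP py ym] eq_s.
  have [_ _ ->] := scaleP (Om x xm); have [_ _ ->] := scaleP (Om y ym).
  by rewrite eq_s px py.
move=> gap_m.
have sect_sep t : primitive t -> separated (sect t m).
  by move=> /gap_m/andP[_]; move/gap2_separated; apply; apply: sorted_sect.
have in_sect x : x \in enum_mset m -> scale x \in sect (primitive_factor x) m.
  by move=> xm; apply/mem_sect => //; exists x.
split=> [x xm x_prim|].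
  have [_ t_prim _] := scaleP (Om x xm).
  have /andP[/allP/(_ _ (in_sect x xm)) + _] := gap_m _ t_prim.
  by have [+ _] := scaleMn (ltn0Sn 0) x_prim; rewrite mul1r => ->.
move=> a b lt_a lt_b neq_ab eq_sect.
(* The multiplicity of a part is that of its scale in a section, and the sections are free of
   repetitions. *)
have m_uniq : uniq (enum_mset m).
  apply: count_mem_uniq => x; rewrite count_mem_mset.
  have [xm|] := boolP (x \in enum_mset m); last by rewrite -count_mem_mset => /count_memPn.
  have [_ t_prim _] := scaleP (Om x xm).
  by rewrite count_sect ?count_uniq_mem ?in_sect //; [case: (sect_sep _ t_prim) | apply: Om].
have am := mem_nth 0 lt_a; have bm := mem_nth 0 lt_b.
have neq_x : nth 0 (enum_mset m) a != nth 0 (enum_mset m) b by rewrite nth_uniq //; apply/eqP.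
move: (nth 0 _ a) (nth 0 _ b) am bm neq_x eq_sect => x y xm ym neq_xy eq_p.
have [_ t_prim Dx] := scaleP (Om x xm); have [_ _ Dy] := scaleP (Om y ym).
have neq_s : scale x != scale y.
  by apply: contraNneq neq_xy => eq_s; rewrite Dx Dy eq_s eq_p.
have [_ /(_ (scale x) (scale y))] := sect_sep _ t_prim.
rewrite in_sect // => /(_ isT); rewrite eq_p in_sect // => /(_ isT neq_s).
by rewrite /gap2; lia.
Qed.

End Lift.

Local Open Scope classical_set_scope.
Local Open Scope card_scope.

Theorem corollary3p10 (K : fieldExtType rat) (hK : totally_real K)
  (d : K) (hd : Oplus d) :
  [set m : {mset K} | partition_of d m /\ scales_2_or_3_mod_5 m] #=
  [set m : {mset K} |
    [/\ partition_of d m, no_primitive_part m & scales_differ_by_2 m]].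
Proof.
rewrite (_ : mkset _ = [set m | partition_of d m /\ sections_in (all mod5_23) m]).
  rewrite [X in _ #= X](_ : _ = [set m | partition_of d m /\ sections_in gap2_parts m]).
    exact/card_sections_in/rogers_ramanujan.
  apply/seteqP; split=> [m [dm np d2]|m [dm gm]] /=.
    by split=> //; apply/(gap2_sections dm.1).
  by have [np d2] := (gap2_sections dm.1).2 gm.
apply/seteqP; split=> m [dm m23]; split=> //.
  exact/(scales_2_or_3_sections dm.1).
exact/(scales_2_or_3_sections dm.1).
Qed.
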